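(* There exists a function $C:[0,\infty)\times[0,\infty)\to(0,\infty)$ such that the following holds. Let $R>0$, let $B_{2R}(0)\subset\mathbb{R}^2$, let $\Theta\in C^2(B_{2R}(0))$ satisfy $-\pi<\Theta<\pi$, and let $u$ be a smooth solution on $B_{2R}(0)$ of $$\arctan\lambda_1+\arctan\lambda_2=\Theta(x),$$ where $\lambda_1,\lambda_2$ are the eigenvalues of $D^2u(x)$. Let $V=\sqrt{\det\big(I_2+(D^2u)^2\big)}$. Then $$\frac{1}{|B_R|}\int_{B_R(0)}V\,dx\ \le\ C\Big(1+\big(1+\tfrac{1}{R^2}\big)\|Du\|_{L^\infty(B_{2R}(0))}^2+\big(1+\tfrac1R\big)\|Du\|_{L^\infty(B_{2R}(0))}\Big),$$ where $C=C\big(\|D\Theta\|_{L^\infty(B_{2R}(0))},\|D^2\Theta\|_{L^\infty(B_{2R}(0))}\big)$.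
   Context: $|B_R|$ denotes the Lebesgue measure (area) of a ball of radius $R$ in $\mathbb{R}^2$. $V$ is the volume density of the metric $g=I_2+(D^2u)^2$ induced on the gradient graph $\{(x,Du(x))\}\subset\mathbb{R}^2\times\mathbb{R}^2$. The estimate is understood for finite norms. *)

(* Defs.v *)
From HB Require Import structures.
From mathcomp Require Import all_boot all_order all_algebra.
From mathcomp Require Import all_classical all_reals all_analysis.

Set Implicit Arguments.
Unset Strict Implicit.
Unset Printing Implicit Defensive.
Import Order.TTheory GRing.Theory Num.Theory.
Import numFieldNormedType.Exports.

Local Open Scope classical_set_scope.
Local Open Scope ring_scope.

(* The plane is represented by [R * R]: unlike ['rV[R]_2] it carries both a
   normed module structure and a product sigma-algebra.  The library norm on
   [R * R] is the max norm, hence the Euclidean disk and norms defined here. *)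

Definition area (R : realType) :
    {measure set (measurableTypeR R * measurableTypeR R) -> \bar R} :=
  (@lebesgue_measure R \x @lebesgue_measure R)%E.

Definition disk (R : realType) (r : R) : set (R * R) :=
  [set p | Num.sqrt (p.1 ^+ 2 + p.2 ^+ 2) < r].

Definition basis_vec (R : realType) (i : 'I_2) : R * R :=
  ((i == 0)%:R, (i == 1)%:R).

Definition partial (R : realType) (i : 'I_2) (f : R * R -> R) : R * R -> R :=
  fun p => 'D_(basis_vec R i) f p.

(* For open [D]: all partial derivatives of [f] of order at most [k] exist and
   are continuous on [D].  Functions are total, but only their values on [D]
   matter. *)
Fixpoint is_Ck (R : realType) (k : nat) (D : set (R * R)) (f : R * R -> R)
    : Prop :=
  {in D, continuous f} /\
  if k is k'.+1 then
    forall i : 'I_2, {in D, forall p, derivable f p (basis_vec R i)} /\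
                     is_Ck k' D (partial i f)
  else True.

Definition smooth (R : realType) (D : set (R * R)) (f : R * R -> R) : Prop :=
  forall k, is_Ck k D f.

Definition grad (R : realType) (f : R * R -> R) (p : R * R) : 'rV[R]_2 :=
  \row_(i < 2) partial i f p.

Definition hess (R : realType) (f : R * R -> R) (p : R * R) : 'M[R]_2 :=
  \matrix_(i < 2, j < 2) partial i (partial j f) p.

(* Euclidean norm of a row vector, Frobenius norm of a matrix. *)
Definition enorm (R : realType) (m n : nat) (A : 'M[R]_(m, n)) : R :=
  Num.sqrt (\sum_(i < m) \sum_(j < n) A i j ^+ 2).

Definition Linfty (R : realType) (m n : nat) (D : set (R * R))
    (F : R * R -> 'M[R]_(m, n)) : \bar R :=
  'N[area R]_(+oo)%E[(fun p => (enorm (F p))%:E) \_ D].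

(* [l1] and [l2] are the eigenvalues of [A], counted with multiplicity. *)
Definition eigenvalues2 (R : realType) (A : 'M[R]_2) (l1 l2 : R) : Prop :=
  char_poly A = ('X - l1%:P) * ('X - l2%:P).

Definition vol_density (R : realType) (u : R * R -> R) (p : R * R) : R :=
  Num.sqrt (\det (1%:M + hess u p *m hess u p)).

(* Main.v *)
Require Import Defs.
From mathcomp Require Import all_boot all_order all_algebra.
From mathcomp Require Import all_classical all_reals all_analysis.
From mathcomp Require Import measurable_realfun ess_sup_inf.
From mathcomp Require Import ring lra.
Import Order.TTheory GRing.Theory Num.Theory.
Import numFieldNormedType.Exports.
Set Implicit Arguments.
Unset Strict Implicit.
Unset Printing Implicit Defensive.
Local Open Scope classical_set_scope.
Local Open Scope ring_scope.

(* Since [V cos Theta = 1 - det D^2u] and [V sin Theta = tr D^2u], we have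
   [V = cos Theta (1 - det D^2u) + sin Theta tr D^2u].  Multiply by a cutoff
   [phi] and put [w = phi cos Theta], [z = phi sin Theta].  The Laplacian is a
   divergence and the Hessian determinant a double divergence of products of
   first derivatives of [u], so two integrations by parts leave an integral
   containing only [w], [D^2w], [Dz] and [Du], which is bounded pointwise.

   All the integrations take place on the square [[-s, s]^2] with [s = 7r/5],
   which contains the disk of radius [r] and lies in the disk of radius [2r];
   the cutoff is a product of two quartic polynomials with double zeros at [s]
   and [-s], so that it vanishes to first order on the boundary of the square
   and exceeds [1/20] on the disk of radius [r]. *)

Local Notation mplane R := (measurableTypeR R * measurableTypeR R)%type.

(** * Measurability on the plane *)

Lemma nbhs_plane_square (R : realType) (p : R * R) (A : set (R * R)) :
  nbhs p A ->
  exists2 e : R, 0 < e &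
    forall q, `|q.1 - p.1| < e -> `|q.2 - p.2| < e -> A q.
Proof.
move=> /nbhs_ballP[e /= e0 He]; exists e => // q h1 h2.
by apply: He; split; rewrite /ball /= distrC.
Qed.

(** The product sigma-algebra contains the rectangles, and an open set is the countable union of the
    rational boxes that it contains. Boxes with corners not contained in [A] are replaced by [set0],
    so that the union is indexed by all quadruples of rationals. *)
Lemma open_measurable_plane (R : realType) (A : set (R * R)) :
  open A -> measurable (A : set (mplane R)).
Proof.
move=> oA.
pose box (q : (rat * rat) * (rat * rat)) : set (R * R) :=
  `]ratr q.1.1, ratr q.1.2[%classic `*` `]ratr q.2.1, ratr q.2.2[%classic.
have -> : A = \bigcup_q (if `[< box q `<=` A >] then box q else set0).
  apply/seteqP; split => [p Ap|p [q _]]; last by case: asboolP => // + pq; exact.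
  have [e e0 He] := nbhs_plane_square (open_nbhs_nbhs (conj oA Ap)).
  have lo (x : R) : x - e < x by lra.
  have hi (x : R) : x < x + e by lra.
  have [a /itvP ha] := rat_in_itvoo (lo p.1).
  have [b /itvP hb] := rat_in_itvoo (hi p.1).
  have [c /itvP hc] := rat_in_itvoo (lo p.2).
  have [d /itvP hd] := rat_in_itvoo (hi p.2).
  exists ((a, b), (c, d)) => //; case: asboolP => [_|].
    by split; rewrite /= in_itv /= ?ha ?hb ?hc ?hd.
  case=> q [] /=; rewrite !in_itv /= => /andP[q1 q2] /andP[q3 q4].
  have : p.1 - e < ratr a by rewrite ha.
  have : ratr b < p.1 + e by rewrite hb.
  have : p.2 - e < ratr c by rewrite hc.
  have : ratr d < p.2 + e by rewrite hd.
  move=> *; apply: He; rewrite ltr_norml; apply/andP; split; lra.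
apply: countable_bigcupT_measurable => [|q].
  exact: countableP.
by case: ifP => // _; apply: measurableX; exact: measurable_itv.
Qed.

Lemma continuous_in_measurable_plane (R : realType) (D : set (R * R))
    (f : R * R -> R) :
  open D -> {in D, continuous f} ->
  measurable_fun (D : set (mplane R)) f.
Proof.
move=> oD cf; apply: (measurability _ (RGenOpens.measurableE R)).
move=> _ [_ [a [b ->] <-]]; apply: open_measurable_plane.
rewrite openE => p [Dp fp]; apply: filterI.
  by move: oD; rewrite openE; exact.
apply: cf; first by rewrite inE.
by apply: open_nbhs_nbhs; split => //; exact: interval_open.
Qed.

Lemma area_box (R : realType) (a b c d : R) : a <= b -> c <= d ->
  area R (`[a, b]%classic `*` `[c, d]%classic) = ((b - a) * (d - c))%:E.
Proof.
move=> ab cd; rewrite [LHS](@product_measure1E _ _ _ _ R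
  (@lebesgue_measure R) (@lebesgue_measure R)) //.
have len (x y : R) : x <= y -> lebesgue_measure `[x, y]%classic = (y - x)%:E.
  move=> xy; rewrite lebesgue_measure_itv /= lte_fin.
  by case: ltgtP xy => // ->; rewrite subrr.
by rewrite EFinM -(len _ _ ab) -(len _ _ cd).
Qed.

(** A value above [M] at one point of [D] would persist, by continuity, on a small square around it;
    the square has positive area and would lie in a null set. This is how essential bounds become
    bounds at every point. *)
Lemma continuous_ae_le (R : realType) (D : set (R * R)) (f : R * R -> R)
    (M : R) :
  open D -> {in D, continuous f} ->
  {ae area R, forall p, D p -> f p <= M} -> forall p, D p -> f p <= M.
Proof.
move=> oD cf [N [mN N0 HN]] p Dp; rewrite leNgt; apply/negP => Mfp.
have : nbhs p (D `&` f @^-1` `]M, +oo[%classic).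
  apply: filterI; first by move: oD; rewrite openE; exact.
  apply: cf; first by rewrite inE.
  apply: open_nbhs_nbhs; split; first exact: interval_open.
  by rewrite /= in_itv /= andbT.
move=> /nbhs_plane_square[e e0 He].
pose S : set (R * R) := `[p.1 - e / 2, p.1 + e / 2]%classic `*`
  `[p.2 - e / 2, p.2 + e / 2]%classic.
have SN : S `<=` N.
  move=> q [] /=; rewrite !in_itv /= => /andP[q1 q2] /andP[q3 q4].
  apply: HN => /= H.
  have [Dq] : (D `&` f @^-1` `]M, +oo[%classic) q.
    by apply: He; rewrite ltr_norml; apply/andP; split; lra.
  by rewrite /= in_itv /= andbT ltNge H.
have : (area R S <= area R N)%E.
  apply: le_measure; rewrite ?inE //.
  by apply: measurableX; exact: measurable_itv.
have lt_half x : x - e / 2 <= x + e / 2 by lra.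
rewrite N0 (area_box (lt_half _) (lt_half _)).
by rewrite lee_fin leNgt => /negP; apply; apply: mulr_gt0; lra.
Qed.

(** * Directional derivatives *)

(** Both difference quotients are the same function of [h], so a directional derivative is an
    ordinary derivative along a line. The one-variable calculus is transported to the plane through
    this equivalence. *)
Lemma is_derive_line (R : realType) (V : normedModType R) (f : V -> R)
    (p v : V) (df : R) (g : R -> R) (x : R) :
  (forall h, g (h + x) = f (h *: v + p)) ->
  is_derive p v f df <-> is_derive x 1 g df.
Proof.
move=> fg.
have E : (fun h : R => h^-1 *: ((f \o shift p) (h *: v) - f p)) =
         (fun h : R => h^-1 *: ((g \o shift x) (h *: (1 : R)) - g x)).
  apply/funext => h /=; rewrite -fg [h *: 1]mulr1.
  by have := fg 0; rewrite scale0r !add0r => ->.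
by split=> -[dv dval]; split; rewrite /derivable /derive ?E in dv dval *;
  rewrite -?E in dv dval *.
Qed.

Lemma is_derive_section1 (R : realType) (f : R * R -> R) (p : R * R) (df : R) :
  is_derive p (basis_vec R 0) f df -> is_derive p.1 1 (fun t => f (t, p.2)) df.
Proof.
apply: (proj1 (is_derive_line _ _)) => h; congr f.
by case: p => x y; congr pair; rewrite /= ?scaler0 ?add0r // [h *: _]mulr1.
Qed.

Lemma is_derive_section2 (R : realType) (f : R * R -> R) (p : R * R) (df : R) :
  is_derive p (basis_vec R 1) f df -> is_derive p.2 1 (fun t => f (p.1, t)) df.
Proof.
apply: (proj1 (is_derive_line _ _)) => h; congr f.
by case: p => x y; congr pair; rewrite /= ?scaler0 ?add0r // [h *: _]mulr1.
Qed.

(** The inner function is only known to be derivable in the direction [v], so the chain rule is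
    taken on the line [h *: v + p]. *)
Lemma is_derive_comp1 (R : realType) (V : normedModType R) (k : R -> R)
    (f : V -> R) (p v : V) (dk df : R) :
  is_derive (f p) 1 k dk -> is_derive p v f df ->
  is_derive p v (fun q => k (f q)) (dk * df).
Proof.
move=> hk hf.
pose g := fun h : R => f (h *: v + p).
have hg : is_derive (0 : R) (1 : R) g df.
  by apply: (proj1 (is_derive_line _ _)) hf => h; rewrite /g addr0.
apply: (proj2 (@is_derive_line _ _ _ p v _ (k \o g) 0 _)).
  by move=> h; rewrite /g /= addr0.
by apply: is_derive1_comp; rewrite /g scale0r add0r.
Qed.

(* Two applications of the mean value theorem; exchanging the roles of the
   variables gives the symmetry of second derivatives. *)
Lemma second_difference (R : realType) (F F1 F12 : R -> R -> R) (a b h : R) :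
  0 < h ->
  (forall x y, a <= x <= a + h -> b <= y <= b + h ->
    is_derive x 1 (F^~ y) (F1 x y) /\ is_derive y 1 (F1 x) (F12 x y)) ->
  exists x y, [/\ a <= x <= a + h, b <= y <= b + h &
    F (a + h) (b + h) - F (a + h) b - (F a (b + h) - F a b) = F12 x y * h * h].
Proof.
move=> h0 dF.
have ah (c : R) : c < c + h by lra.
pose G t := F t (b + h) - F t b.
have bb : b <= b <= b + h by lra.
have bh : b <= b + h <= b + h by lra.
have dG x : a <= x <= a + h -> is_derive x 1 G (F1 x (b + h) - F1 x b).
  move=> ax.
  by apply: is_deriveB; [exact: (dF _ _ ax bh).1|exact: (dF _ _ ax bb).1].
have [||x] := MVT (ah a) (df := fun x => F1 x (b + h) - F1 x b) (f := G).
- by move=> x; rewrite in_itv /= => ax; apply: dG; lra.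
- apply: derivable_within_continuous => x; rewrite in_itv /= => ax.
  by have [] := dG x ax.
rewrite in_itv /= => /andP[ax xa] EG.
have ax' : a <= x <= a + h by lra.
have [||y] := MVT (ah b) (df := F12 x) (f := F1 x).
- by move=> y; rewrite in_itv /= => yb; apply: (dF _ _ _ _).2; lra.
- apply: derivable_within_continuous => y; rewrite in_itv /= => yb.
  by have [_ []] := dF _ _ ax' yb.
rewrite in_itv /= => yb EF.
exists x, y; split => //; first lra.
move: EG; rewrite /G => ->; rewrite EF; ring.
Qed.

Section Ck.
Variables (R : realType) (D : set (R * R)).

Lemma is_Ck_continuous k f : is_Ck k D f -> {in D, continuous f}.
Proof. by case: k => [|k] []. Qed.

Lemma is_Ck_partial k f i : is_Ck k.+1 D f -> is_Ck k D (partial i f).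
Proof. by case=> _ /(_ i)[]. Qed.

Lemma is_Ck_derive k f i p : is_Ck k.+1 D f -> D p ->
  is_derive p (basis_vec R i) f (partial i f p).
Proof. by case=> _ /(_ i)[df _] Dp; split => //; apply: df; rewrite inE. Qed.

Lemma is_CkS k f : is_Ck k.+1 D f -> is_Ck k D f.
Proof.
elim: k f => [|k IH] f [cf df]; split=> // i; have [? ?] := df i.
by split=> //; exact: IH.
Qed.

(** On a small square with corner [p], each mixed derivative, at some point of the square, times the
    squared side equals the same second difference. By continuity both values are within [|d| / 2]
    of those at [p], where [d] is the supposed nonzero gap; this gives [|d| < |d|]. *)
Lemma partial_sym f p : open D -> is_Ck 2 D f -> D p ->
  partial 0 (partial 1 f) p = partial 1 (partial 0 f) p.
Proof.
move=> oD f2 Dp; apply/eqP; rewrite -subr_eq0 -normr_le0 leNgt.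
set d := _ - _; apply/negP => d0.
have c10 := is_Ck_continuous (is_Ck_partial 1 (is_Ck_partial 0 f2)).
have c01 := is_Ck_continuous (is_Ck_partial 0 (is_Ck_partial 1 f2)).
have pD : p \in D by rewrite inE.
have d20 : 0 < `|d| / 2 by lra.
have n10 : \forall q \near p,
    `|partial 1 (partial 0 f) p - partial 1 (partial 0 f) q| < `|d| / 2.
  by have /cvgrPdist_lt/(_ _ d20) := c10 _ pD.
have n01 : \forall q \near p,
    `|partial 0 (partial 1 f) p - partial 0 (partial 1 f) q| < `|d| / 2.
  by have /cvgrPdist_lt/(_ _ d20) := c01 _ pD.
have nD : nbhs p D by move: oD; rewrite openE; exact.
have [e e0 He] := nbhs_plane_square (filterI nD (filterI n10 n01)).
have h0 : 0 < e / 2 by lra.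
have near x y : p.1 <= x <= p.1 + e / 2 -> p.2 <= y <= p.2 + e / 2 ->
  [/\ D (x, y),
    `|partial 1 (partial 0 f) p - partial 1 (partial 0 f) (x, y)| < `|d| / 2 &
    `|partial 0 (partial 1 f) p - partial 0 (partial 1 f) (x, y)| < `|d| / 2].
  move=> hx hy; have [] := He (x, y).
  - by rewrite /= ltr_norml; apply/andP; split; lra.
  - by rewrite /= ltr_norml; apply/andP; split; lra.
  by move=> Dxy [B1 B2].
have [] := @second_difference R (fun x y => f (x, y))
  (fun x y => partial 0 f (x, y))
  (fun x y => partial 1 (partial 0 f) (x, y)) p.1 p.2 _ h0.
  move=> x y hx hy; have [Dxy _ _] := near _ _ hx hy; split.
    exact: (is_derive_section1 (is_Ck_derive 0 f2 Dxy)).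
  exact: (is_derive_section2 (is_Ck_derive 1 (is_Ck_partial 0 f2) Dxy)).
move=> x1 [y1 [hx1 hy1 E1]].
have [] := @second_difference R (fun y x => f (x, y))
  (fun y x => partial 1 f (x, y))
  (fun y x => partial 0 (partial 1 f) (x, y)) p.2 p.1 _ h0.
  move=> y x hy hx; have [Dxy _ _] := near _ _ hx hy; split.
    exact: (is_derive_section2 (is_Ck_derive 1 f2 Dxy)).
  exact: (is_derive_section1 (is_Ck_derive 0 (is_Ck_partial 1 f2) Dxy)).
move=> y2 [x2 [hy2 hx2 E2]].
have [_ n1 _] := near _ _ hx1 hy1.
have [_ _ n2] := near _ _ hx2 hy2.
(* The two second differences have the same four terms in a different order; cancelling [e / 2]
   twice identifies the two intermediate values. *)
have EE : partial 1 (partial 0 f) (x1, y1) = partial 0 (partial 1 f) (x2, y2).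
  have hn : e / 2 != 0 by rewrite gt_eqF.
  have key (c c' x y z t : R) : x - y - (z - t) = c * (e / 2) * (e / 2) ->
      x - z - (y - t) = c' * (e / 2) * (e / 2) -> c = c'.
    have -> : x - y - (z - t) = x - z - (y - t) by ring.
    by move=> -> /(mulIf hn)/(mulIf hn).
  exact: key E1 E2.
have : `|d| < `|d| / 2 + `|d| / 2.
  apply: le_lt_trans (ltrD n2 n1).
  rewrite EE [X in _ <= _ + X]distrC; apply: le_trans (ler_normD _ _).
  by rewrite /d addrA subrK.
by rewrite -splitr ltxx.
Qed.

End Ck.

(** * Integration over squares *)

Lemma integral_is_derive (R : realType) (F f : R -> R) (a b : R) : a < b ->
  (forall x, a <= x <= b -> is_derive x 1 F (f x)) ->
  (forall x, a <= x <= b -> {for x, continuous f}) ->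
  (\int[lebesgue_measure]_(x in `[a, b]) (f x)%:E = (F b)%:E - (F a)%:E)%E.
Proof.
move=> ab dF cf.
have cF x : a <= x <= b -> {for x, continuous F}.
  move=> /dF[dFx _].
  by apply: differentiable_continuous; apply/derivable1_diffP.
apply: continuous_FTC2 => //.
- by apply: continuous_in_subspaceT => x; rewrite inE /= in_itv /=; exact: cf.
- split.
  + move=> x; rewrite in_itv /= => /andP[ax xb].
    by apply: (@ex_derive _ _ _ _ _ _ _ (dF x _)); lra.
  + by apply: cvg_at_right_filter; apply: cF; lra.
  + by apply: cvg_at_left_filter; apply: cF; lra.
- move=> x; rewrite in_itv /= => /andP[ax xb]; rewrite derive1E.
  by apply: (@derive_val _ _ _ _ _ _ _ (dF x _)); lra.
Qed.

Definition square (R : realType) (s : R) : set (R * R) :=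
  `[- s, s]%classic `*` `[- s, s]%classic.

Section square.
Variables (R : realType) (s : R).
Let Q : set (mplane R) := square s.

Lemma measurable_square : measurable Q.
Proof. by apply: measurableX; exact: measurable_itv. Qed.

Lemma area_square : 0 <= s -> area R Q = (4 * s ^+ 2)%:E.
Proof.
move=> s0; have ss : - s <= s by lra.
by rewrite (area_box ss ss); congr (_%:E); ring.
Qed.

Lemma squareP (p : R * R) :
  square s p <-> (- s <= p.1 <= s) && (- s <= p.2 <= s).
Proof.
split=> [[]|/andP[? ?]]; first by rewrite /= !in_itv /= => -> ->.
by split; rewrite /= in_itv.
Qed.

(** The square is compact, so [f] is bounded on it, and a bounded measurable function is integrable
    on a set of finite area. *)
Lemma integrable_square (D : set (R * R)) (f : R * R -> R) :
  0 <= s -> open D -> square s `<=` D -> {in D, continuous f} ->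
  (area R).-integrable Q (EFin \o f).
Proof.
move=> s0 oD QD cf; apply: measurable_bounded_integrable.
- exact: measurable_square.
- by rewrite area_square // ltry.
- apply: (measurable_funS _ QD); first exact: open_measurable_plane.
  exact: continuous_in_measurable_plane.
- have cQ : compact (square s) by apply: compact_setX; exact: segment_compact.
  have wf : {within square s, continuous f}.
    apply: continuous_in_subspaceT => p; rewrite inE => /QD Dp.
    by apply: cf; rewrite inE.
  have /compact_bounded[M [_ mrt]] := continuous_compact wf cQ.
  by exists M; split; rewrite ?num_real // => ? ? ? ?; exact: mrt.
Qed.

(** Fubini is applied on the whole plane to the extension of [f] by zero, and the extension is then
    undone in each variable. Here the first coordinate is integrated innermost, as suits a
    derivative along the first axis; [integral_square2] has the other order. *)
Lemma integral_square1 (f : R * R -> R) :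
  (area R).-integrable Q (EFin \o f) ->
  (\int[area R]_(p in Q) (f p)%:E = \int[lebesgue_measure]_(y in `[(- s)%R, s])
     \int[lebesgue_measure]_(x in `[(- s)%R, s]) (f (x, y))%:E)%E.
Proof.
move=> intf; rewrite integral_mkcond.
have intf' := (proj1 (integrable_mkcond _ measurable_square)) intf.
rewrite -(integral21_prod_meas1 intf') [RHS]integral_mkcond.
apply: eq_integral => y _; rewrite /fubini_G /patch.
case: ifPn => ys; last first.
  apply: integral0_eq => x _; rewrite ifF //; apply/negbTE; apply: contra ys.
  by rewrite !inE => -[].
rewrite [RHS]integral_mkcond; apply: eq_integral => x _; rewrite /patch.
congr (if _ then _ else _).
move: ys; rewrite inE => ys; apply/idP/idP; rewrite !inE; [by case|by []].
Qed.

Lemma integral_square2 (f : R * R -> R) :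
  (area R).-integrable Q (EFin \o f) ->
  (\int[area R]_(p in Q) (f p)%:E = \int[lebesgue_measure]_(x in `[(- s)%R, s])
     \int[lebesgue_measure]_(y in `[(- s)%R, s]) (f (x, y))%:E)%E.
Proof.
move=> intf; rewrite integral_mkcond.
have intf' := (proj1 (integrable_mkcond _ measurable_square)) intf.
rewrite -(integral12_prod_meas1 intf') [RHS]integral_mkcond.
apply: eq_integral => x _; rewrite /fubini_F /patch.
case: ifPn => xs; last first.
  apply: integral0_eq => y _; rewrite ifF //; apply/negbTE; apply: contra xs.
  by rewrite !inE => -[].
rewrite [RHS]integral_mkcond; apply: eq_integral => y _; rewrite /patch.
congr (if _ then _ else _).
move: xs; rewrite inE => xs; apply/idP/idP; rewrite !inE; [by case|by []].
Qed.

(** On each horizontal segment the fundamental theorem of calculus gives [A (s, y) - A (- s, y)],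
    which is zero. Together with its counterpart for the second axis this is the divergence theorem
    for fields without boundary terms. *)
Lemma integral_square_partial1 (D : set (R * R)) (A dA : R * R -> R) :
  0 < s -> open D -> square s `<=` D -> {in D, continuous dA} ->
  (forall p, D p -> is_derive p (basis_vec R 0) A (dA p)) ->
  (forall y, A (s, y) = 0 /\ A (- s, y) = 0) ->
  (\int[area R]_(p in Q) (dA p)%:E = 0)%E.
Proof.
move=> s0 oD QD cdA derA A0.
rewrite integral_square1; last exact: (integrable_square (ltW s0) oD).
apply: integral0_eq => y; rewrite /= in_itv /= => ys.
have Dxy x : - s <= x <= s -> D (x, y).
  by move=> xs; apply: QD; apply/squareP; rewrite xs ys.
apply: etrans (@integral_is_derive _ (fun x => A (x, y)) (fun x => dA (x, y))
  (- s) s _ _ _) _; last by have [-> ->] := A0 y; rewrite subee.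
- lra.
- by move=> x /Dxy/derA/is_derive_section1.
move=> x /Dxy/mem_set Dx; apply: (@continuous_comp _ _ _ (fun t => (t, y)) dA).
  exact: (cvg_pair cvg_id (cvg_cst y)).
exact: (cdA _ Dx).
Qed.

Lemma integral_square_partial2 (D : set (R * R)) (A dA : R * R -> R) :
  0 < s -> open D -> square s `<=` D -> {in D, continuous dA} ->
  (forall p, D p -> is_derive p (basis_vec R 1) A (dA p)) ->
  (forall x, A (x, s) = 0 /\ A (x, - s) = 0) ->
  (\int[area R]_(p in Q) (dA p)%:E = 0)%E.
Proof.
move=> s0 oD QD cdA derA A0.
rewrite integral_square2; last exact: (integrable_square (ltW s0) oD).
apply: integral0_eq => x; rewrite /= in_itv /= => xs.
have Dxy y : - s <= y <= s -> D (x, y).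
  by move=> ys; apply: QD; apply/squareP; rewrite xs ys.
apply: etrans (@integral_is_derive _ (fun y => A (x, y)) (fun y => dA (x, y))
  (- s) s _ _ _) _; last by have [-> ->] := A0 x; rewrite subee.
- lra.
- by move=> y /Dxy/derA/is_derive_section2.
move=> y /Dxy/mem_set Dy; apply: (@continuous_comp _ _ _ (fun t => (x, t)) dA).
  exact: (cvg_pair (cvg_cst x) cvg_id).
exact: (cdA _ Dy).
Qed.

End square.

(** * Volume density and cutoff *)

Lemma det_mx2 (R : comNzRingType) (M : 'M[R]_2) :
  \det M = M 0 0 * M 1 1 - M 0 1 * M 1 0.
Proof.
rewrite (expand_det_row _ ord0) !big_ord_recl big_ord0 /cofactor !det_mx11 !mxE.
have -> : lift ord0 ord0 = 1 :> 'I_2 by apply/val_inj.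
have -> : lift 1 0 = 0 :> 'I_2 by apply/val_inj.
have -> : ord0 = 0 :> 'I_2 by apply/val_inj.
rewrite /=; ring.
Qed.

Lemma trace_mx2 (R : nzRingType) (M : 'M[R]_2) : \tr M = M 0 0 + M 1 1.
Proof.
rewrite /mxtrace !big_ord_recl big_ord0 addr0.
have -> : lift ord0 ord0 = 1 :> 'I_2 by apply/val_inj.
by have -> : ord0 = 0 :> 'I_2 by apply/val_inj.
Qed.

(** With a formal square root [i] of -1, [I + M^2] factors as [(I + i M) (I - i M)], and the
    determinant of [I + i M] is [(1 - det M) + i tr M]. *)
Lemma det_one_add_sqr (R : comNzRingType) (M : 'M[R]_2) :
  \det (1%:M + M *m M) = (1 - \det M) ^+ 2 + (\tr M) ^+ 2.
Proof.
have mm i j : (M *m M) i j = M i 0 * M 0 j + M i 1 * M 1 j.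
  rewrite mxE !big_ord_recl big_ord0 addr0.
  have -> : lift ord0 ord0 = 1 :> 'I_2 by apply/val_inj.
  by have -> : ord0 = 0 :> 'I_2 by apply/val_inj.
rewrite !det_mx2 trace_mx2 ![(1%:M + _) _ _]mxE !mm !mxE /=; ring.
Qed.

(** The characteristic polynomial gives the determinant [l1 * l2] and the trace [l1 + l2]. With [a]
    and [b] the square roots of [1 + l1 ^+ 2] and [1 + l2 ^+ 2], the density is [a * b], while the
    addition formulas give [cos T = (1 - l1 * l2) / (a * b)] and [sin T = (l1 + l2) / (a * b)]. *)
Lemma vol_density_lagrangian (R : realType) (u : R * R -> R) (p : R * R)
    (l1 l2 T : R) :
  eigenvalues2 (hess u p) l1 l2 -> atan l1 + atan l2 = T ->
  vol_density u p = cos T *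
    (1 - (partial 0 (partial 0 u) p * partial 1 (partial 1 u) p -
          partial 0 (partial 1 u) p * partial 1 (partial 0 u) p)) +
    sin T * (partial 0 (partial 0 u) p + partial 1 (partial 1 u) p).
Proof.
move=> eig <-; rewrite /vol_density; set H := hess u p in eig *.
have detH : \det H = l1 * l2.
  have := char_poly_det H; rewrite eig coef0M !coefB !coefX !coefC /=.
  by rewrite !sub0r mulrNN expr2 mulrNN mulr1 mul1r => <-.
have trH : \tr H = l1 + l2.
  have := char_poly_trace (n := 2) H isT; rewrite eig => /(congr1 -%R).
  have -> : ('X - l1%:P) * ('X - l2%:P) =
      'X * 'X - (l1 + l2)%:P * 'X + (l1 * l2)%:P :> {poly R}.
    by rewrite polyCD polyCM; ring.
  rewrite opprK => <-; rewrite !(coefD, coefN, coefMX, coefCM, coefX, coefC) /=.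
  by ring.
have HE i j : H i j = partial i (partial j u) p by rewrite mxE.
rewrite -!HE.
rewrite -det_mx2 -trace_mx2 det_one_add_sqr.
have sin_at l : sin (atan l) = l * cos (atan l).
  rewrite -{2}(atanK l) /tan divfK // cos_atan invr_eq0 sqrtr_eq0 -ltNge; nra.
rewrite detH trH cosD sinD !sin_at !cos_atan.
set a := Num.sqrt (1 + l1 ^+ 2); set b := Num.sqrt (1 + l2 ^+ 2).
have a2 : a ^+ 2 = 1 + l1 ^+ 2 by rewrite sqr_sqrtr //; nra.
have b2 : b ^+ 2 = 1 + l2 ^+ 2 by rewrite sqr_sqrtr //; nra.
have a0 : a > 0 by rewrite sqrtr_gt0; nra.
have b0 : b > 0 by rewrite sqrtr_gt0; nra.
have -> : (1 - l1 * l2) ^+ 2 + (l1 + l2) ^+ 2 = (a * b) ^+ 2.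
  by rewrite exprMn a2 b2; ring.
rewrite sqrtr_sqr gtr0_norm ?mulr_gt0 //.
have -> : a * b = (a ^+ 2 * b ^+ 2) / (a * b) by field; rewrite !gt_eqF.
rewrite a2 b2; field; by rewrite !gt_eqF.
Qed.

Section derive_rules.
Variables (R : realType) (V : normedModType R).
Implicit Types (f g : V -> R) (p v : V).

Lemma is_derive_add f g p v df dg : is_derive p v f df -> is_derive p v g dg ->
  is_derive p v (fun q => f q + g q) (df + dg).
Proof. exact: is_deriveD. Qed.

Lemma is_derive_opp f p v df : is_derive p v f df ->
  is_derive p v (fun q => - f q) (- df).
Proof. exact: is_deriveN. Qed.

Lemma is_derive_mul f g p v df dg : is_derive p v f df -> is_derive p v g dg ->
  is_derive p v (fun q => f q * g q) (df * g p + f p * dg).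
Proof.
move=> hf hg; apply: (is_derive_eq (is_deriveM hf hg)).
by rewrite addrC; congr (_ + _); exact: mulrC.
Qed.

Lemma is_derive_const (c : R) p v : is_derive p v (fun=> c) 0.
Proof. exact: is_derive_cst. Qed.

End derive_rules.

Lemma is_derive_fst (R : realType) (p v : R * R) :
  is_derive p v (fun q : R * R => q.1) v.1.
Proof.
apply: (proj2 (@is_derive_line _ _ _ p v _ (fun t : R => t * v.1 + p.1) 0 _)).
  by move=> h; rewrite addr0.
apply: (is_derive_eq (is_derive_add (is_derive_mul (is_derive_id _ _)
  (is_derive_const _ _ _)) (is_derive_const _ _ _))).
by rewrite mul1r mulr0 !addr0.
Qed.

Lemma is_derive_snd (R : realType) (p v : R * R) :
  is_derive p v (fun q : R * R => q.2) v.2.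
Proof.
apply: (proj2 (@is_derive_line _ _ _ p v _ (fun t : R => t * v.2 + p.2) 0 _)).
  by move=> h; rewrite addr0.
apply: (is_derive_eq (is_derive_add (is_derive_mul (is_derive_id _ _)
  (is_derive_const _ _ _)) (is_derive_const _ _ _))).
by rewrite mul1r mulr0 !addr0.
Qed.

Section cutoff.
Variables (R : realType) (c : R).

(** For [c = 1 / s ^+ 2] this is [(1 - (t / s) ^+ 2) ^+ 2]. Squares are written as products so that
    the product rules for derivatives and continuity apply directly. *)
Definition cutoff (t : R) := (1 - c * (t * t)) * (1 - c * (t * t)).
Definition cutoff1 (t : R) := - 4 * c * t * (1 - c * (t * t)).
Definition cutoff2 (t : R) := 12 * c * c * (t * t) - 4 * c.

Let dpoly (t : R) : is_derive t 1 (fun t => 1 - c * (t * t)) (- (2 * c * t)).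
Proof.
apply: (is_derive_eq (is_derive_add (is_derive_const _ _ _) (is_derive_opp
  (is_derive_mul (is_derive_const c _ _)
     (is_derive_mul (is_derive_id _ _) (is_derive_id _ _)))))).
by ring.
Qed.

Lemma is_derive_cutoff (t : R) : is_derive t 1 cutoff (cutoff1 t).
Proof.
apply: (is_derive_eq (is_derive_mul (dpoly t) (dpoly t))).
by rewrite /cutoff1; ring.
Qed.

Lemma is_derive_cutoff1 (t : R) : is_derive t 1 cutoff1 (cutoff2 t).
Proof.
apply: (is_derive_eq (is_derive_mul (is_derive_mul
  (is_derive_const (- 4 * c) _ _) (is_derive_id _ _)) (dpoly t))).
by rewrite /cutoff2; ring.
Qed.

Variable s : R.
Hypotheses (s0 : 0 < s) (cs : c * s ^+ 2 = 1).

Lemma cutoff_eq0 (t : R) : t ^+ 2 = s ^+ 2 -> cutoff t = 0 /\ cutoff1 t = 0.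
Proof.
by rewrite /cutoff /cutoff1 -[t * t]expr2 => ->; rewrite cs subrr !mulr0.
Qed.

(** The number [rho] is an inverse length with [1 / s <= rho], so [c <= rho ^+ 2] and
    [c * s <= rho]. With [x = c * (t * t)] in [[0, 1]], the three functions are [(1 - x) ^+ 2],
    [- 4 * (c * t) * (1 - x)] and [c * (12 * x - 4)]; the last factor lies between -4 and 8. *)
Lemma cutoff_bounds (t rho : R) : - s <= t <= s -> 0 <= rho -> 1 <= rho * s ->
  [/\ 0 <= cutoff t <= 1, `|cutoff1 t| <= 4 * rho &
      `|cutoff2 t| <= 8 * rho ^+ 2].
Proof.
move=> /andP[ts1 ts2] rho0 rhos.
have c0 : 0 < c.
  by rewrite -(pmulr_lgt0 _ (exprn_gt0 2 s0)) cs.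
have crho : c <= rho ^+ 2.
  rewrite -(ler_pM2r (exprn_gt0 2 s0)) cs; nra.
have csr : c * s <= rho.
  rewrite -(ler_pM2r s0) -mulrA -expr2 cs //.
have tt : t * t <= s ^+ 2 by nra.
set x := c * (t * t).
have x0 : 0 <= x by rewrite /x; nra.
have x1 : x <= 1 by rewrite /x -cs ler_pM2l.
split.
- by rewrite /cutoff -/x; apply/andP; split; nra.
- have -> : cutoff1 t = - (4 * (c * t) * (1 - x)) by rewrite /cutoff1 -/x; ring.
  rewrite normrN !normrM (ger0_norm (_ : 0 <= 1 - x)); last lra.
  rewrite (ger0_norm (_ : 0 <= 4)) // -[4 * rho]mulr1.
  rewrite ler_pM ?mulr_ge0 //; [lra| |lra].
  rewrite ler_pM2l // (le_trans _ csr) // (gtr0_norm c0) ler_pM2l //.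
  by rewrite ler_norml ts1.
- have -> : cutoff2 t = c * (12 * x - 4) by rewrite /cutoff2 /x; ring.
  rewrite normrM (gtr0_norm c0) mulrC ler_pM //; first exact: ltW.
  by rewrite ler_norml; apply/andP; split; lra.
Qed.

End cutoff.

(** * Integration by parts *)

Section continuous_at_rules.
Variables (R : realType) (T : topologicalType) (p : T).
Implicit Types f g : T -> R.

Lemma continuous_at_add f g : continuous_at p f -> continuous_at p g ->
  continuous_at p (fun q => f q + g q).
Proof. exact: cvgD. Qed.

Lemma continuous_at_opp f : continuous_at p f ->
  continuous_at p (fun q => - f q).
Proof. exact: cvgN. Qed.

Lemma continuous_at_mul f g : continuous_at p f -> continuous_at p g ->
  continuous_at p (fun q => f q * g q).
Proof. exact: cvgM. Qed.

Lemma continuous_at_const (c : R) : continuous_at p (fun=> c).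
Proof. exact: cvg_cst. Qed.

End continuous_at_rules.

(** The recursion follows the syntax of the function and closes its leaves by hypotheses.
    Differences and divisions by constants are covered, being sums with an opposite and products
    with a constant inverse. *)
Ltac continuity :=
  lazymatch goal with
  | |- continuous_at ?p (fun q => @?f q + @?g q) =>
      apply: (@continuous_at_add _ _ p f g); continuity
  | |- continuous_at ?p (fun q => - @?f q) =>
      apply: (@continuous_at_opp _ _ p f); continuity
  | |- continuous_at ?p (fun q => @?f q * @?g q) =>
      apply: (@continuous_at_mul _ _ p f g); continuity
  | |- continuous_at ?p (fun=> ?c) => exact: continuous_at_const
  | H : continuous_at ?p ?f |- continuous_at ?p ?f => exact: H
  | H : continuous_at ?p ?f |- continuous_at ?p (fun q => ?f q) => exact: H
  end.

(* [ui] stands for the derivative of [u] in the [i]-th direction (counted from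
   1), [uij] for the derivative of [ui] in the [j]-th one; likewise for the
   weights [w] and [z].  Third derivatives of [u] occur only in [dA] and [dB],
   and cancel by symmetry. *)
Section weighted_identity.
Variables (R : realType) (D : set (R * R)) (s : R).
Variables u1 u2 u11 u12 u21 u22 u221 u212 : R * R -> R.
Variables w w1 w2 w11 w12 w22 z z1 z2 : R * R -> R.
Hypotheses (s0 : 0 < s) (oD : open D) (QD : square s `<=` D).

Let e0 := basis_vec R 0.
Let e1 := basis_vec R 1.

Hypothesis du : forall p, D p ->
  [/\ is_derive p e0 u1 (u11 p), is_derive p e1 u1 (u12 p),
      is_derive p e0 u2 (u21 p) & is_derive p e1 u2 (u22 p)] /\
  (is_derive p e0 u22 (u221 p) /\ is_derive p e1 u21 (u212 p)).
Hypothesis cu : forall p, D p ->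
  [/\ continuous_at p u1, continuous_at p u2, continuous_at p u11,
      continuous_at p u12 & continuous_at p u21] /\
  [/\ continuous_at p u22, continuous_at p u221 & continuous_at p u212].
Hypothesis sym : forall p, D p -> u21 p = u12 p /\ u221 p = u212 p.
Hypothesis dw : forall p, D p ->
  [/\ is_derive p e0 w (w1 p), is_derive p e1 w (w2 p),
      is_derive p e0 w1 (w11 p), is_derive p e1 w1 (w12 p) &
      is_derive p e1 w2 (w22 p)].
Hypothesis dz : forall p, D p ->
  is_derive p e0 z (z1 p) /\ is_derive p e1 z (z2 p).
Hypothesis cw : forall p, D p ->
  [/\ continuous_at p w, continuous_at p w1, continuous_at p w2,
      continuous_at p w11 & continuous_at p w12] /\ continuous_at p w22.
Hypothesis cz : forall p, D p ->
  [/\ continuous_at p z, continuous_at p z1 & continuous_at p z2].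
Hypothesis bd1 : forall p, p.1 ^+ 2 = s ^+ 2 ->
  [/\ w p = 0, w1 p = 0 & z p = 0].
Hypothesis bd2 : forall p, p.2 ^+ 2 = s ^+ 2 ->
  [/\ w p = 0, w1 p = 0, w2 p = 0 & z p = 0].

(** These are the terms left once all derivatives have been moved from [u] to the weights: half the
    cofactor matrix of the Hessian of [w] evaluated on the gradient of [u], minus the product of the
    gradients of [z] and [u]. *)
Let rest p := w22 p * (u1 p * u1 p) / 2 - w12 p * (u1 p * u2 p) +
  w11 p * (u2 p * u2 p) / 2 - z1 p * u1 p - z2 p * u2 p.
(** [A] and [B] are the components of the field whose divergence is discarded. The terms in [z]
    account for the Laplacian; those in [w] write the Hessian determinant as the first derivative of
    [u1 * u22] minus the second derivative of [u1 * u21]; those in [w1] and [w2] perform the second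
    integration by parts. The weights required to vanish in [bd1] and [bd2] are those occurring in
    [A] and in [B] respectively. *)
Let A p := z p * u1 p + - (w p * (u1 p * u22 p)) + - (w1 p * (u2 p * u2 p) / 2).
Let B p := z p * u2 p + w p * (u1 p * u21 p) + - (w2 p * (u1 p * u1 p) / 2) +
  w1 p * (u1 p * u2 p).
Let dA p := z1 p * u1 p + z p * u11 p +
  - (w1 p * (u1 p * u22 p) + w p * (u11 p * u22 p + u1 p * u221 p)) +
  - (w11 p * (u2 p * u2 p) / 2 + w1 p * (u2 p * u21 p)).
Let dB p := z2 p * u2 p + z p * u22 p +
  (w2 p * (u1 p * u21 p) + w p * (u12 p * u21 p + u1 p * u212 p)) +
  - (w22 p * (u1 p * u1 p) / 2 + w2 p * (u1 p * u12 p)) +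
  (w12 p * (u1 p * u2 p) + w1 p * (u12 p * u2 p + u1 p * u22 p)).

Lemma weighted_hessian_identity p : D p ->
  w p * (1 - (u11 p * u22 p - u21 p * u12 p)) + z p * (u11 p + u22 p) =
  w p + rest p + dA p + dB p.
Proof.
move=> Dp.
have [s2 s3] := sym Dp.
by rewrite /rest /dA /dB s3 s2; field.
Qed.

Let der_A p : D p -> is_derive p e0 A (dA p).
Proof.
move=> Dp; have [[? ? ? ?] [? ?]] := du Dp.
have [? ? ? ? ?] := dw Dp; have [? ?] := dz Dp.
(* Instance resolution differentiates [A] from the hypotheses just introduced, and the result is
   compared with [dA]. *)
by apply: is_derive_eq; rewrite /dA /GRing.scale /=; field.
Qed.

Let der_B p : D p -> is_derive p e1 B (dB p).
Proof.
move=> Dp; have [[? ? ? ?] [? ?]] := du Dp.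
have [? ? ? ? ?] := dw Dp; have [? ?] := dz Dp.
by apply: is_derive_eq; rewrite /dB /GRing.scale /=; field.
Qed.

Let cont_all p : D p -> [/\ continuous_at p (fun q => w q + rest q),
  continuous_at p dA & continuous_at p dB].
Proof.
move=> Dp; have [[? ? ? ? ?] [? ? ?]] := cu Dp.
have [[? ? ? ? ?] ?] := cw Dp; have [? ? ?] := cz Dp.
split; rewrite /rest /dA /dB; continuity.
Qed.

(** By the pointwise identity the integrand is [w + rest] plus a divergence. The divergence
    integrates to zero because [A] vanishes on the vertical sides and [B] on the horizontal ones,
    and the remainder is at most [K] times the area of the square. *)
Lemma integral_weighted_hessian_le (K : R) :
  (forall p, square s p -> w p + rest p <= K) ->
  (\int[area R]_(p in (square s : set (mplane R)))
     (w p * (1 - (u11 p * u22 p - u21 p * u12 p)) + z p * (u11 p + u22 p))%:E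
   <= (K * (4 * s ^+ 2))%:E)%E.
Proof.
move=> HK.
have iW : (area R).-integrable (square s) (EFin \o (fun q => w q + rest q)).
  by apply: integrable_square (ltW s0) oD QD _ => p; rewrite inE => /cont_all[].
have iA : (area R).-integrable (square s) (EFin \o dA).
  by apply: integrable_square (ltW s0) oD QD _ => p; rewrite inE => /cont_all[].
have iB : (area R).-integrable (square s) (EFin \o dB).
  by apply: integrable_square (ltW s0) oD QD _ => p; rewrite inE => /cont_all[].
have mQ := measurable_square s.
under eq_integral => p.
  rewrite inE => /QD Dp; rewrite weighted_hessian_identity // !EFinD.
  over.
have A0 : (\int[area R]_(p in (square s : set (mplane R))) (dA p)%:E = 0)%E.
  apply: (integral_square_partial1 s0 oD QD _ der_A) => [p|y].
    by rewrite inE => /cont_all[].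
  have bd t : t ^+ 2 = s ^+ 2 -> A (t, y) = 0.
    by move=> ts; rewrite /A; have [//|-> -> ->] := @bd1 (t, y); ring.
  by split; apply: bd; rewrite ?sqrrN.
have B0 : (\int[area R]_(p in (square s : set (mplane R))) (dB p)%:E = 0)%E.
  apply: (integral_square_partial2 s0 oD QD _ der_B) => [p|x].
    by rewrite inE => /cont_all[].
  have bd t : t ^+ 2 = s ^+ 2 -> B (x, t) = 0.
    by move=> ts; rewrite /B; have [//|-> -> -> ->] := @bd2 (x, t); ring.
  by split; apply: bd; rewrite ?sqrrN.
rewrite integralD //; last exact: (integrableD mQ iW iA).
rewrite integralD // A0 B0 !adde0.
apply: le_trans
  (_ : (\int[area R]_(p in (square s : set (mplane R))) K%:E <= _)%E).
  apply: le_integral => //.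
    apply: (integrable_square (f := fun=> K) (ltW s0) oD QD) => p _.
    exact: cvg_cst.
  by move=> p; rewrite inE => /HK; rewrite -EFinD lee_fin.
by rewrite integral_cst // (area_square (ltW s0)) -EFinM.
Qed.

End weighted_identity.

(** * Pointwise bounds *)

Section norm_bounds.
Variable R : realDomainType.
Implicit Types x y X Y : R.

Lemma norm_le_add x y X Y : `|x| <= X -> `|y| <= Y -> `|x + y| <= X + Y.
Proof. by move=> hx hy; apply: le_trans (ler_normD _ _) (lerD hx hy). Qed.

Lemma norm_le_opp x X : `|x| <= X -> `|- x| <= X.
Proof. by rewrite normrN. Qed.

Lemma norm_le_mul x y X Y : `|x| <= X -> `|y| <= Y -> `|x * y| <= X * Y.
Proof. by move=> hx hy; rewrite normrM ler_pM. Qed.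

End norm_bounds.

(** The right-hand side is meant to be an existential variable, as after [apply: le_trans]: the
    triangle inequality builds the bound along the syntax, with the leaves bounded by hypotheses. *)
Ltac norm_bound :=
  lazymatch goal with
  | |- is_true (`|_ + _| <= _) => apply: norm_le_add; norm_bound
  | |- is_true (`|- _| <= _) => apply: norm_le_opp; norm_bound
  | |- is_true (`|_ * _| <= _) => apply: norm_le_mul; norm_bound
  | H : is_true (`|?x| <= _) |- is_true (`|?x| <= _) => exact: H
  end.

(** The letters stand for a cutoff [phi], the cosine [C] and sine [S] of the phase, and the
    derivatives [T1], [T2], [T11], [T12], [T22] of the phase. The numbers [a] and [b] bound the
    first and second derivatives of the phase, [U] those of the potential, and [rho] is the inverse
    length scale of the cutoff. *)
Section cutoff_weights.
Variables (R : realType) (D : set (R * R)) (s rho a b U : R).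
Variables phi phi1 phi2 phi11 phi12 phi22 C S T1 T2 T11 T12 T22 : R * R -> R.
Variables u1 u2 u11 u12 u21 u22 u221 u212 : R * R -> R.
Hypotheses (s0 : 0 < s) (oD : open D) (QD : square s `<=` D).

Let e0 := basis_vec R 0.
Let e1 := basis_vec R 1.

Hypothesis du : forall p, D p ->
  [/\ is_derive p e0 u1 (u11 p), is_derive p e1 u1 (u12 p),
      is_derive p e0 u2 (u21 p) & is_derive p e1 u2 (u22 p)] /\
  (is_derive p e0 u22 (u221 p) /\ is_derive p e1 u21 (u212 p)).
Hypothesis cu : forall p, D p ->
  [/\ continuous_at p u1, continuous_at p u2, continuous_at p u11,
      continuous_at p u12 & continuous_at p u21] /\
  [/\ continuous_at p u22, continuous_at p u221 & continuous_at p u212].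
Hypothesis sym : forall p, D p -> u21 p = u12 p /\ u221 p = u212 p.

Hypothesis dphi : forall p, D p ->
  [/\ is_derive p e0 phi (phi1 p), is_derive p e1 phi (phi2 p),
      is_derive p e0 phi1 (phi11 p), is_derive p e1 phi1 (phi12 p) &
      is_derive p e1 phi2 (phi22 p)].
Hypothesis dCS : forall p, D p ->
  [/\ is_derive p e0 C (- S p * T1 p), is_derive p e1 C (- S p * T2 p),
      is_derive p e0 S (C p * T1 p) & is_derive p e1 S (C p * T2 p)].
Hypothesis dT : forall p, D p ->
  [/\ is_derive p e0 T1 (T11 p), is_derive p e1 T1 (T12 p) &
      is_derive p e1 T2 (T22 p)].
Hypothesis cphi : forall p, D p ->
  [/\ continuous_at p phi, continuous_at p phi1 & continuous_at p phi2] /\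
  [/\ continuous_at p phi11, continuous_at p phi12 & continuous_at p phi22].
Hypothesis cT : forall p, D p ->
  [/\ continuous_at p C, continuous_at p S, continuous_at p T1 &
      continuous_at p T2] /\
  [/\ continuous_at p T11, continuous_at p T12 & continuous_at p T22].
Hypothesis bd1 : forall p, p.1 ^+ 2 = s ^+ 2 -> phi p = 0 /\ phi1 p = 0.
Hypothesis bd2 : forall p, p.2 ^+ 2 = s ^+ 2 ->
  [/\ phi p = 0, phi1 p = 0 & phi2 p = 0].
Hypothesis bphi : forall p, square s p ->
  [/\ `|phi p| <= 1, `|phi1 p| <= 4 * rho & `|phi2 p| <= 4 * rho] /\
  [/\ `|phi11 p| <= 16 * rho ^+ 2, `|phi12 p| <= 16 * rho ^+ 2 &
      `|phi22 p| <= 16 * rho ^+ 2].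
Hypothesis bT : forall p, square s p ->
  [/\ `|C p| <= 1, `|S p| <= 1, `|T1 p| <= a & `|T2 p| <= a] /\
  [/\ `|T11 p| <= b, `|T12 p| <= b & `|T22 p| <= b].
Hypothesis bu : forall p, square s p -> `|u1 p| <= U /\ `|u2 p| <= U.

Let w p := phi p * C p.
Let z p := phi p * S p.
Let w1 p := phi1 p * C p + - (phi p * (S p * T1 p)).
Let w2 p := phi2 p * C p + - (phi p * (S p * T2 p)).
Let z1 p := phi1 p * S p + phi p * (C p * T1 p).
Let z2 p := phi2 p * S p + phi p * (C p * T2 p).
Let w11 p := phi11 p * C p + - (phi1 p * (S p * T1 p)) +
  - (phi1 p * (S p * T1 p)) + - (phi p * (C p * (T1 p * T1 p) + S p * T11 p)).
Let w12 p := phi12 p * C p + - (phi1 p * (S p * T2 p)) +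
  - (phi2 p * (S p * T1 p)) + - (phi p * (C p * (T1 p * T2 p) + S p * T12 p)).
Let w22 p := phi22 p * C p + - (phi2 p * (S p * T2 p)) +
  - (phi2 p * (S p * T2 p)) + - (phi p * (C p * (T2 p * T2 p) + S p * T22 p)).

(** The weights are [w = phi * C] and [z = phi * S]. By the Leibniz rule the second derivatives of
    [w] are at most [M = 16 * rho ^+ 2 + 2 * (4 * rho * a) + (a ^+ 2 + b)], and the first ones of
    [z] at most [4 * rho + a]. The quadratic terms of the remainder have coefficients 1/2, 1 and
    1/2, which add up to 2, and there are two linear terms. *)
Lemma integral_cutoff_le :
  (\int[area R]_(p in (square s : set (mplane R)))
     (phi p * (C p * (1 - (u11 p * u22 p - u21 p * u12 p)) +
               S p * (u11 p + u22 p)))%:E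
   <= ((1 + 2 * (16 * rho ^+ 2 + 8 * rho * a + a ^+ 2 + b) * U ^+ 2 +
        2 * (4 * rho + a) * U) * (4 * s ^+ 2))%:E)%E.
Proof.
under eq_integral => p _ do rewrite mulrDr !mulrA.
apply: (@integral_weighted_hessian_le R D s u1 u2 u11 u12 u21 u22 u221 u212
  w w1 w2 w11 w12 w22 z z1 z2 s0 oD QD du cu sym) => p.
- move=> Dp; have [? ? ? ? ?] := dphi Dp; have [? ? ? ?] := dCS Dp.
  have [? ? ?] := dT Dp.
  by split; apply: is_derive_eq;
    rewrite /w1 /w2 /w11 /w12 /w22 /GRing.scale /=; ring.
- move=> Dp; have [? ? ? ? ?] := dphi Dp; have [? ? ? ?] := dCS Dp.
  by split; apply: is_derive_eq; rewrite /z1 /z2 /GRing.scale /=; ring.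
- move=> Dp; have [[? ? ?] [? ? ?]] := cphi Dp.
  have [[? ? ? ?] [? ? ?]] := cT Dp.
  by split; [split|]; rewrite /w /w1 /w2 /w11 /w12 /w22; continuity.
- move=> Dp; have [[? ? ?] [? ? ?]] := cphi Dp.
  have [[? ? ? ?] [? ? ?]] := cT Dp.
  by split; rewrite /z /z1 /z2; continuity.
- by move=> /bd1[E E1]; rewrite /w /w1 /z E E1; split; ring.
- by move=> /bd2[E E1 E2]; rewrite /w /w1 /w2 /z E E1 E2; split; ring.
move=> Qp; have [[? ? ?] [? ? ?]] := bphi Qp.
have [[? ? ? ?] [? ? ?]] := bT Qp; have [? ?] := bu Qp.
set M := 16 * _ + _ + _ + _.
have b11 : `|w11 p| <= M.
  rewrite /w11; apply: le_trans; first norm_bound; rewrite /M; lra.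
have b12 : `|w12 p| <= M.
  rewrite /w12; apply: le_trans; first norm_bound; rewrite /M; lra.
have b22 : `|w22 p| <= M.
  rewrite /w22; apply: le_trans; first norm_bound; rewrite /M; lra.
have bz1 : `|z1 p| <= 4 * rho + a.
  rewrite /z1; apply: le_trans; first norm_bound; lra.
have bz2 : `|z2 p| <= 4 * rho + a.
  rewrite /z2; apply: le_trans; first norm_bound; lra.
have bw : `|w p| <= 1.
  rewrite /w; apply: le_trans; first norm_bound; lra.
(* The leaves of [norm_bound] are closed by hypotheses only, so the constant factor needs one too.
   After [clearbody] only the bounds on the weights remain. *)
have half : `|2^-1 : R| <= 2^-1 by rewrite ger0_norm.
apply: le_trans (ler_norm _) _; clearbody w z w1 w2 z1 z2 w11 w12 w22 M.
by apply: le_trans; first norm_bound; lra.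
Qed.

End cutoff_weights.

(** * Disks and essential bounds *)

Section tensor.
Variables (R : realType) (p : R * R).

Lemma is_derive_comp_fst (k k' : R -> R) (i : 'I_2) :
  (forall t : R, is_derive t 1 k (k' t)) ->
  is_derive p (basis_vec R i) (fun q => k q.1) ((i == 0)%:R * k' p.1).
Proof.
move=> dk; have := is_derive_comp1 (dk _) (is_derive_fst p (basis_vec R i)).
by rewrite mulrC.
Qed.

Lemma is_derive_comp_snd (k k' : R -> R) (i : 'I_2) :
  (forall t : R, is_derive t 1 k (k' t)) ->
  is_derive p (basis_vec R i) (fun q => k q.2) ((i == 1)%:R * k' p.2).
Proof.
move=> dk; have := is_derive_comp1 (dk _) (is_derive_snd p (basis_vec R i)).
by rewrite mulrC.
Qed.

Lemma is_derive_tensor (k k' l l' : R -> R) (i : 'I_2) :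
  (forall t : R, is_derive t 1 k (k' t)) ->
  (forall t : R, is_derive t 1 l (l' t)) ->
  is_derive p (basis_vec R i) (fun q => k q.1 * l q.2)
    ((i == 0)%:R * k' p.1 * l p.2 + k p.1 * ((i == 1)%:R * l' p.2)).
Proof.
move=> dk dl.
exact: is_derive_mul (is_derive_comp_fst i dk) (is_derive_comp_snd i dl).
Qed.

End tensor.

Lemma disk_sqr (R : realType) (r : R) (p : R * R) : 0 < r ->
  disk r p <-> p.1 ^+ 2 + p.2 ^+ 2 < r ^+ 2.
Proof.
move=> r0; rewrite /disk /=.
have -> : (Num.sqrt (p.1 ^+ 2 + p.2 ^+ 2) < r) =
    (Num.sqrt (p.1 ^+ 2 + p.2 ^+ 2) < Num.sqrt (r ^+ 2)).
  by rewrite sqrtr_sqr gtr0_norm.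
by rewrite ltr_sqrt ?exprn_gt0.
Qed.

Lemma continuous_at_fst (R : realType) (p : R * R) :
  continuous_at p (fun q : R * R => q.1).
Proof. exact: cvg_fst. Qed.

Lemma continuous_at_snd (R : realType) (p : R * R) :
  continuous_at p (fun q : R * R => q.2).
Proof. exact: cvg_snd. Qed.

Lemma open_disk (R : realType) (r : R) : 0 < r -> open (disk r).
Proof.
move=> r0.
have -> : disk r =
    (fun p => p.1 * p.1 + p.2 * p.2) @^-1` `]-oo, (r ^+ 2)[%classic.
  apply/seteqP; split => p; rewrite /= in_itv /= -!expr2.
    by move=> /(disk_sqr _ r0).
  by move=> /(disk_sqr _ r0).
apply: open_comp; last exact: interval_open.
move=> p _; have ? := @continuous_at_fst R p; have ? := @continuous_at_snd R p.
change (continuous_at p (fun q : R * R => q.1 * q.1 + q.2 * q.2)); continuity.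
Qed.

Lemma square_sub_disk (R : realType) (s r : R) : 0 < r -> 2 * s ^+ 2 < r ^+ 2 ->
  square s `<=` disk r.
Proof.
move=> r0 sr p /squareP /andP[/andP[? ?] /andP[? ?]]; apply/disk_sqr => //.
have : p.1 ^+ 2 <= s ^+ 2 by nra.
have : p.2 ^+ 2 <= s ^+ 2 by nra.
lra.
Qed.

Lemma disk_sub_square (R : realType) (r : R) : 0 < r -> disk r `<=` square r.
Proof.
move=> r0 p /(disk_sqr _ r0) h; apply/squareP.
by apply/andP; split; apply/andP; split; nra.
Qed.

(** The square of half-side [r / 2] lies in the disk and already has area [r ^+ 2]. A lower bound is
    what is needed, since the area is divided by. *)
Lemma area_disk_ge (R : realType) (r : R) : 0 < r ->
  ((r ^+ 2)%:E <= area R (disk r))%E.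
Proof.
move=> r0; have h0 : 0 <= r / 2 by lra.
have <- : area R (square (r / 2)) = (r ^+ 2)%:E.
  by rewrite area_square //; congr (_%:E); field.
apply: le_measure; rewrite ?inE.
- exact: measurable_square.
- exact: open_measurable_plane (open_disk r0).
- by apply: square_sub_disk => //; nra.
Qed.

Lemma entry_le_enorm (R : realType) (m n : nat) (A : 'M[R]_(m, n)) i j :
  `|A i j| <= enorm A.
Proof.
rewrite -sqrtr_sqr /enorm ler_wsqrtr // (bigD1 i) //= (bigD1 j) //=.
rewrite -addrA lerDl addr_ge0 // sumr_ge0 // => k _; first exact: sqr_ge0.
by rewrite sumr_ge0 // => l _; exact: sqr_ge0.
Qed.

(** An entry is at most the Euclidean norm, hence almost everywhere at most the essential supremum;
    continuity on the open set extends the bound to every point. *)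
Lemma entry_le_Linfty (R : realType) (m n : nat) (D : set (R * R))
    (F : R * R -> 'M[R]_(m, n)) i j :
  open D -> {in D, continuous (fun p => F p i j)} -> (Linfty D F < +oo)%E ->
  forall p, D p -> `|F p i j| <= fine (Linfty D F).
Proof.
move=> oD cF Foo.
have F0 : (0 <= Linfty D F)%E by exact: Lnorm_ge0.
have FE : Linfty D F = (fine (Linfty D F))%:E by rewrite fineK // ge0_fin_numE.
apply: (continuous_ae_le (f := fun p => `|F p i j|) oD).
  by move=> p Dp; apply: cvg_norm; exact: (cF p Dp).
(* The norm of exponent [+oo] unfolds to an essential supremum once the whole plane is known to have
   positive measure. *)
have area0 : (0 < area R setT)%E.
  apply: lt_le_trans (_ : (area R (square 1) <= _)%E); last first.
    by apply: le_measure; rewrite ?inE //; exact: measurable_square.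
  by rewrite area_square // lte_fin; lra.
have := ess_sup_ge (area R) (abse \o (fun p => (enorm (F p))%:E) \_ D).
have -> : ess_sup (area R) (abse \o (fun p => (enorm (F p))%:E) \_ D) =
    Linfty D F.
  by rewrite /Linfty unlock area0.
apply: filterS => p + Dp; rewrite FE /= /patch mem_set //= lee_fin.
apply: le_trans; rewrite (le_trans (entry_le_enorm _ _ _)) // ler_norm //.
Qed.

(** * The estimate *)

(** The estimate for abstract weights is applied to the product cutoff and to the cosine and sine of
    [Theta], whose derivatives come from the chain rule. *)
Lemma integral_cutoff_lagrangian_le (R : realType) (D : set (R * R))
    (s c rho a b U : R) (Theta u : R * R -> R) :
  0 < s -> c * s ^+ 2 = 1 -> 0 <= rho -> 1 <= rho * s ->
  open D -> square s `<=` D -> is_Ck 2 D Theta -> is_Ck 3 D u ->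
  (forall i p, D p -> `|partial i u p| <= U) ->
  (forall i p, D p -> `|partial i Theta p| <= a) ->
  (forall i j p, D p -> `|partial i (partial j Theta) p| <= b) ->
  (\int[area R]_(p in (square s : set (mplane R)))
     (cutoff c p.1 * cutoff c p.2 *
       (cos (Theta p) *
          (1 - (partial 0 (partial 0 u) p * partial 1 (partial 1 u) p -
                partial 0 (partial 1 u) p * partial 1 (partial 0 u) p)) +
        sin (Theta p) *
          (partial 0 (partial 0 u) p + partial 1 (partial 1 u) p)))%:E
   <= ((1 + 2 * (16 * rho ^+ 2 + 8 * rho * a + a ^+ 2 + b) * U ^+ 2 +
        2 * (4 * rho + a) * U) * (4 * s ^+ 2))%:E)%E.
Proof.
move=> s0 cs rho0 rhos oD QD T2 u3 bu bT bTT.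
have cc k f p : is_Ck k D f -> D p -> continuous_at p f.
  by move=> fk Dp; exact: (is_Ck_continuous fk (mem_set Dp)).
have u1C := is_Ck_partial 0 u3; have u2C := is_Ck_partial 1 u3.
have u2 := is_CkS u3.
have T1C := is_Ck_partial 0 T2; have T2C := is_Ck_partial 1 T2.
have dB := is_derive_cutoff c; have dB1 := is_derive_cutoff1 c.
apply: (@integral_cutoff_le R D s rho a b U
  (fun p => cutoff c p.1 * cutoff c p.2) (fun p => cutoff1 c p.1 * cutoff c p.2)
  (fun p => cutoff c p.1 * cutoff1 c p.2)
  (fun p => cutoff2 c p.1 * cutoff c p.2)
  (fun p => cutoff1 c p.1 * cutoff1 c p.2)
  (fun p => cutoff c p.1 * cutoff2 c p.2)
  (fun p => cos (Theta p)) (fun p => sin (Theta p))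
  (partial 0 Theta) (partial 1 Theta) (partial 0 (partial 0 Theta))
  (partial 1 (partial 0 Theta)) (partial 1 (partial 1 Theta))
  (partial 0 u) (partial 1 u) (partial 0 (partial 0 u))
  (partial 1 (partial 0 u)) (partial 0 (partial 1 u)) (partial 1 (partial 1 u))
  (partial 0 (partial 1 (partial 1 u))) (partial 1 (partial 0 (partial 1 u)))
  s0 oD QD) => p.
- move=> Dp; split; split.
  + exact: (is_Ck_derive 0 u1C Dp).
  + exact: (is_Ck_derive 1 u1C Dp).
  + exact: (is_Ck_derive 0 u2C Dp).
  + exact: (is_Ck_derive 1 u2C Dp).
  + exact: (is_Ck_derive 0 (is_Ck_partial 1 u2C) Dp).
  + exact: (is_Ck_derive 1 (is_Ck_partial 0 u2C) Dp).
- move=> Dp; split; split.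
  + exact: (cc _ _ _ u1C Dp).
  + exact: (cc _ _ _ u2C Dp).
  + exact: (cc _ _ _ (is_Ck_partial 0 u1C) Dp).
  + exact: (cc _ _ _ (is_Ck_partial 1 u1C) Dp).
  + exact: (cc _ _ _ (is_Ck_partial 0 u2C) Dp).
  + exact: (cc _ _ _ (is_Ck_partial 1 u2C) Dp).
  + exact: (cc _ _ _ (is_Ck_partial 0 (is_Ck_partial 1 u2C)) Dp).
  + exact: (cc _ _ _ (is_Ck_partial 1 (is_Ck_partial 0 u2C)) Dp).
(* The required identity between third derivatives of [u] is the symmetry of the second derivatives
   of [partial 1 u]. *)
- move=> Dp; split; first exact: partial_sym oD u2 Dp.
  exact: partial_sym oD u2C Dp.
- move=> _; split.
  + apply: (is_derive_eq (@is_derive_tensor R p _ _ _ _ 0 dB dB)).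
    by rewrite mul1r mul0r mulr0 addr0.
  + apply: (is_derive_eq (@is_derive_tensor R p _ _ _ _ 1 dB dB)).
    by rewrite !mul0r add0r mul1r.
  + apply: (is_derive_eq (@is_derive_tensor R p _ _ _ _ 0 dB1 dB)).
    by rewrite mul1r mul0r mulr0 addr0.
  + apply: (is_derive_eq (@is_derive_tensor R p _ _ _ _ 1 dB1 dB)).
    by rewrite !mul0r add0r mul1r.
  + apply: (is_derive_eq (@is_derive_tensor R p _ _ _ _ 1 dB dB1)).
    by rewrite !mul0r add0r mul1r.
- move=> Dp; split.
  + exact: is_derive_comp1 (is_derive_cos _) (is_Ck_derive 0 T2 Dp).
  + exact: is_derive_comp1 (is_derive_cos _) (is_Ck_derive 1 T2 Dp).
  + exact: is_derive_comp1 (is_derive_sin _) (is_Ck_derive 0 T2 Dp).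
  + exact: is_derive_comp1 (is_derive_sin _) (is_Ck_derive 1 T2 Dp).
- move=> Dp; split.
  + exact: (is_Ck_derive 0 T1C Dp).
  + exact: (is_Ck_derive 1 T1C Dp).
  + exact: (is_Ck_derive 1 T2C Dp).
- have ? := @continuous_at_fst R p; have ? := @continuous_at_snd R p.
  by move=> _; split; split; rewrite /cutoff /cutoff1 /cutoff2; continuity.
- move=> Dp; split; split.
  + exact: continuous_comp (cc _ _ _ T2 Dp) (@continuous_cos R _).
  + exact: continuous_comp (cc _ _ _ T2 Dp) (@continuous_sin R _).
  + exact: (cc _ _ _ T1C Dp).
  + exact: (cc _ _ _ T2C Dp).
  + exact: (cc _ _ _ (is_Ck_partial 0 T1C) Dp).
  + exact: (cc _ _ _ (is_Ck_partial 1 T1C) Dp).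
  + exact: (cc _ _ _ (is_Ck_partial 1 T2C) Dp).
- by move=> /(cutoff_eq0 cs)[-> ->]; rewrite !mul0r.
- by move=> /(cutoff_eq0 cs)[-> ->]; rewrite !mulr0.
- move=> /squareP/andP[h1 h2].
  have [x0 x1 x2] := cutoff_bounds s0 cs h1 rho0 rhos.
  have [y0 y1 y2] := cutoff_bounds s0 cs h2 rho0 rhos.
  have {}x0 : `|cutoff c p.1| <= 1.
    by case/andP: x0 => ? ?; rewrite ger0_norm.
  have {}y0 : `|cutoff c p.2| <= 1.
    by case/andP: y0 => ? ?; rewrite ger0_norm.
  (* The pure second derivatives of the product are at most [8 * rho ^+ 2] and the mixed one at most
     [(4 * rho) ^+ 2], so [16 * rho ^+ 2] serves for all three. *)
  by split; split; (apply: le_trans; first norm_bound); nra.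
- move=> /QD Dp; split; split.
  + by rewrite ler_norml cos_geN1 cos_le1.
  + by rewrite ler_norml sin_geN1 sin_le1.
  + exact: (bT 0 p Dp).
  + exact: (bT 1 p Dp).
  + exact: (bTT 0 0 p Dp).
  + exact: (bTT 1 0 p Dp).
  + exact: (bTT 1 1 p Dp).
- by move=> /QD Dp; split; [exact: (bu 0 p Dp)|exact: (bu 1 p Dp)].
Qed.

(** Since [c * r ^+ 2 = 25 / 49], each factor is at least [(24 / 49) ^+ 2], which exceeds
    [23 / 100], and the square of [23 / 100] exceeds [1 / 20]. *)
Lemma cutoff_disk_ge (R : realType) (s r c : R) (p : R * R) :
  0 < r -> c * s ^+ 2 = 1 -> s = 7 / 5 * r -> disk r p ->
  1 / 20 <= cutoff c p.1 * cutoff c p.2.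
Proof.
move=> r0 cs sE /(disk_sub_square r0)/squareP/andP[h1 h2].
have cr : c * r ^+ 2 = 25 / 49.
  have h : 49 / 25 * (c * r ^+ 2) = 1 by apply: etrans cs; rewrite sE; field.
  lra.
have c0 : 0 < c by rewrite -(pmulr_lgt0 _ (exprn_gt0 2 r0)) cr; lra.
have one t : - r <= t <= r -> 23 / 100 <= cutoff c t.
  move=> /andP[t1 t2].
  have x1 : c * (t * t) <= 25 / 49 by rewrite -cr ler_pM2l //; nra.
  rewrite /cutoff; set x := c * _ in x1 *; nra.
have k1 := one _ h1; have k2 := one _ h2.
have q : 0 <= 23 / 100 :> R by lra.
by apply: le_trans (ler_pM q q k1 k2); lra.
Qed.

(** On the small disk the density is at most 20 times its product with the cutoff. That product is
    nonnegative on the square, so its integral only grows when the domain is enlarged to the square,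
    where the cutoff estimate applies with [rho = r^-1]. *)
Lemma mean_vol_density_le (R : realType) (r a b U : R) (Theta u : R * R -> R) :
  0 < r -> is_Ck 2 (disk (2 * r)) Theta -> is_Ck 3 (disk (2 * r)) u ->
  (forall p, disk (2 * r) p -> exists l1 l2 : R,
     eigenvalues2 (hess u p) l1 l2 /\ atan l1 + atan l2 = Theta p) ->
  (forall i p, disk (2 * r) p -> `|partial i u p| <= U) ->
  (forall i p, disk (2 * r) p -> `|partial i Theta p| <= a) ->
  (forall i j p, disk (2 * r) p -> `|partial i (partial j Theta) p| <= b) ->
  ((area R (disk r))^-1 * \int[area R]_(p in disk r) (vol_density u p)%:E <=
   (160 * (1 + 2 * (16 * r^-1 ^+ 2 + 8 * r^-1 * a + a ^+ 2 + b) * U ^+ 2 +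
           2 * (4 * r^-1 + a) * U))%:E)%E.
Proof.
move=> r0 T2 u3 eqn bu bT bTT.
set K := 1 + _ + _.
(* The ratio 7/5 lies between 1 and the square root of 2: the square contains the disk of radius
   [r], and its corners stay inside the disk of radius [2 * r] because
   [2 * s ^+ 2 = 98 / 25 * r ^+ 2]. *)
pose s := 7 / 5 * r; pose c := (s ^+ 2)^-1.
have s0 : 0 < s by rewrite /s; lra.
have cs : c * s ^+ 2 = 1 by rewrite mulVf // sqrf_eq0 gt_eqF.
have rr0 : 0 < 2 * r by lra.
have oD := open_disk rr0.
have QD : square s `<=` disk (2 * r).
  by apply: square_sub_disk => //; rewrite /s; nra.
have rQ : disk r `<=` square s.
  apply: subset_trans (disk_sub_square r0) _ => p /squareP ?.
  by apply/squareP; rewrite /s; lra.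
(* [G] equals the volume density on the large disk. Its continuity is read off this formula, its
   nonnegativity off the square root. *)
pose G p := cos (Theta p) *
  (1 - (partial 0 (partial 0 u) p * partial 1 (partial 1 u) p -
        partial 0 (partial 1 u) p * partial 1 (partial 0 u) p)) +
  sin (Theta p) * (partial 0 (partial 0 u) p + partial 1 (partial 1 u) p).
pose phi (p : R * R) := cutoff c p.1 * cutoff c p.2.
have VG p : disk (2 * r) p -> vol_density u p = G p.
  by move=> /eqn[l1 [l2 [eig T]]]; exact: vol_density_lagrangian eig T.
have rho0 : 0 <= r^-1 by rewrite invr_ge0 ltW.
have rhos : 1 <= r^-1 * s by rewrite /s mulrCA mulVf ?gt_eqF //; lra.
have phi0 p : square s p -> 0 <= phi p.
  move=> /squareP/andP[h1 h2].
  have [/andP[x0 _] _ _] := cutoff_bounds s0 cs h1 rho0 rhos.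
  have [/andP[y0 _] _ _] := cutoff_bounds s0 cs h2 rho0 rhos.
  exact: mulr_ge0.
have G0 p : disk (2 * r) p -> 0 <= G p.
  by move=> /VG <-; exact: sqrtr_ge0.
have cG p : disk (2 * r) p -> continuous_at p G.
  move=> Dp.
  have cc k f : is_Ck k (disk (2 * r)) f -> continuous_at p f.
    by move=> fk; exact: (is_Ck_continuous fk (mem_set Dp)).
  have key (C S h00 h01 h10 h11 : R * R -> R) :
      continuous_at p C -> continuous_at p S -> continuous_at p h00 ->
      continuous_at p h01 -> continuous_at p h10 -> continuous_at p h11 ->
      continuous_at p (fun q => C q * (1 - (h00 q * h11 q - h01 q * h10 q)) +
        S q * (h00 q + h11 q)).
    by move=> ? ? ? ? ? ?; continuity.
  apply: (key (fun q => cos (Theta q)) (fun q => sin (Theta q))).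
  - exact: continuous_comp (cc _ _ T2) (@continuous_cos R _).
  - exact: continuous_comp (cc _ _ T2) (@continuous_sin R _).
  - exact: (cc _ _ (is_Ck_partial 0 (is_Ck_partial 0 u3))).
  - exact: (cc _ _ (is_Ck_partial 0 (is_Ck_partial 1 u3))).
  - exact: (cc _ _ (is_Ck_partial 1 (is_Ck_partial 0 u3))).
  - exact: (cc _ _ (is_Ck_partial 1 (is_Ck_partial 1 u3))).
have cphiG p : disk (2 * r) p -> continuous_at p (fun q => phi q * G q).
  move=> Dp; have ? := cG p Dp.
  have ? := @continuous_at_fst R p; have ? := @continuous_at_snd R p.
  have ? : continuous_at p phi by rewrite /phi /cutoff; continuity.
  by continuity.
have mD (f : R * R -> R) (E : set (mplane R)) :
    (forall p, disk (2 * r) p -> continuous_at p f) ->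
    E `<=` disk (2 * r) ->
    measurable_fun E (fun p : mplane R => (f p)%:E).
  move=> cf ED; apply/measurable_EFinP; apply: measurable_funS ED _.
    exact: open_measurable_plane.
  by apply: continuous_in_measurable_plane oD _ => p; rewrite inE; exact: cf.
have rD : disk r `<=` disk (2 * r) := subset_trans rQ QD.
have mr := open_measurable_plane (open_disk r0).
have mQ := measurable_square s.
have intV : (\int[area R]_(p in disk r) (vol_density u p)%:E <=
    20%:E * (K * (4 * s ^+ 2))%:E)%E.
  under eq_integral => p.
    rewrite inE => /rD/VG ->.
    over.
  have := integral_cutoff_lagrangian_le s0 cs rho0 rhos oD QD T2 u3 bu bT bTT.
  rewrite -(lee_pmul2l (_ : 20%:E \is a fin_num)%E) // ?lte_fin //.
  apply: le_trans.
  rewrite -ge0_integralZl_EFin //; first last.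
  - exact: (mD _ _ cphiG QD).
  - by move=> p Qp; rewrite lee_fin mulr_ge0 ?phi0 ?G0 //; exact: QD.
  have mQG : measurable_fun (square s : set (mplane R))
      (fun p => 20%:E * (phi p * G p)%:E)%E.
    by apply: measurable_funeM; exact: (mD _ _ cphiG QD).
  have pos p : square s p -> (0 <= 20%:E * (phi p * G p)%:E)%E.
    by move=> Qp; rewrite mule_ge0 // lee_fin mulr_ge0 ?phi0 ?G0 //; exact: QD.
  apply: le_trans (ge0_subset_integral (area R) mr mQ mQG pos rQ).
  apply: ge0_le_integral => //.
  - by move=> p /rD/G0; rewrite lee_fin.
  - exact: (mD _ _ cG rD).
  - exact: measurable_funS mQG.
  - move=> p rp /=; rewrite -EFinM lee_fin mulrA.
    have ge1 : 1 <= 20 * phi p.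
      by have := cutoff_disk_ge r0 cs erefl rp; rewrite -/(phi p); lra.
    by rewrite ler_peMl // G0 //; exact: rD.
have K0 : (0 <= \int[area R]_(p in disk r) (vol_density u p)%:E)%E.
  by apply: integral_ge0 => p _; rewrite lee_fin sqrtr_ge0.
have r20 : 0 < r ^+ 2 by rewrite exprn_gt0.
have inv : ((area R (disk r))^-1 <= ((r ^+ 2)^-1)%:E)%E.
  have <- : (((r ^+ 2)%:E)^-1 = ((r ^+ 2)^-1)%:E)%E by rewrite inver gt_eqF.
  rewrite lee_pV2 ?inE //; first exact: area_disk_ge.
  by rewrite lee_fin ltW.
apply: le_trans (lee_pmul _ _ inv intV) _ => //; first by rewrite inve_ge0.
rewrite -!EFinM lee_fin.
(* The factor is [20 * 4 * (7 / 5) ^+ 2 = 784 / 5], rounded up to 160 at the end. *)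
have -> : (r ^+ 2)^-1 * (20 * (K * (4 * s ^+ 2))) = 784 / 5 * K.
  by rewrite /s; field; rewrite gt_eqF.
(* Rounding up requires [0 <= K]; the bounds [U], [a] and [b] are nonnegative because they dominate
   absolute values at the origin. *)
have D0 : disk (2 * r) (0, 0).
  by apply: QD; apply/squareP; rewrite /=; apply/andP; split; lra.
have U0 := le_trans (normr_ge0 _) (bu 0 _ D0).
have a0 := le_trans (normr_ge0 _) (bT 0 _ D0).
have b0 := le_trans (normr_ge0 _) (bTT 0 0 _ D0).
have : 0 <= K by rewrite /K !addr_ge0 ?mulr_ge0 ?addr_ge0 ?mulr_ge0 ?exprn_ge0.
lra.
Qed.

Theorem lemma5p2 (R : realType) :
  exists C : R -> R -> R,
    (forall a b : R, 0 <= a -> 0 <= b -> 0 < C a b) /\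
    forall (r : R) (Theta u : R * R -> R),
      0 < r ->
      is_Ck 2 (disk (2 * r)) Theta ->
      (forall p, disk (2 * r) p -> - pi < Theta p < pi) ->
      smooth (disk (2 * r)) u ->
      (forall p, disk (2 * r) p ->
         exists l1 l2 : R, eigenvalues2 (hess u p) l1 l2 /\
                           atan l1 + atan l2 = Theta p) ->
      (Linfty (disk (2 * r)) (grad u) < +oo)%E ->
      (Linfty (disk (2 * r)) (grad Theta) < +oo)%E ->
      (Linfty (disk (2 * r)) (hess Theta) < +oo)%E ->
      let Du := fine (Linfty (disk (2 * r)) (grad u)) in
      let DTheta := fine (Linfty (disk (2 * r)) (grad Theta)) in
      let D2Theta := fine (Linfty (disk (2 * r)) (hess Theta)) in
      ((area R (disk r))^-1 *
         \int[area R]_(p in disk r) (vol_density u p)%:E <=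
       (C DTheta D2Theta *
         (1 + (1 + 1 / r ^+ 2) * Du ^+ 2 + (1 + 1 / r) * Du))%:E)%E.
Proof.
(* The factor 160 is that of the mean estimate. The other factor [B] is chosen so that, for every
   [rho >= 0], the quadratic coefficient is at most [B * (1 + rho ^+ 2)], the linear one at most
   [B * (1 + rho)], and [1 <= B]. *)
exists (fun a b => 160 * (2 * (16 + 4 * a + a ^+ 2 + b))); split.
  by move=> a b a0 b0; have := sqr_ge0 a; lra.
move=> r Theta u r0 T2 _ usm eqn uoo Too TToo; cbv zeta.
set U := fine (Linfty _ (grad u)); set a := fine (Linfty _ (grad Theta)).
set b := fine (Linfty _ (hess Theta)).
have oD : open (disk (2 * r)) by apply: open_disk; lra.
have u3 : is_Ck 3 (disk (2 * r)) u := usm 3%N.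
have bu i p : disk (2 * r) p -> `|partial i u p| <= U.
  have E : (fun q => grad u q 0 i) = partial i u.
    by apply/funext => q; rewrite mxE.
  move=> Dp; have := entry_le_Linfty (i := 0) (j := i) oD _ uoo Dp.
  by rewrite E mxE; apply; exact: is_Ck_continuous (is_Ck_partial i u3).
have bT i p : disk (2 * r) p -> `|partial i Theta p| <= a.
  have E : (fun q => grad Theta q 0 i) = partial i Theta.
    by apply/funext => q; rewrite mxE.
  move=> Dp; have := entry_le_Linfty (i := 0) (j := i) oD _ Too Dp.
  by rewrite E mxE; apply; exact: is_Ck_continuous (is_Ck_partial i T2).
have bTT i j p : disk (2 * r) p -> `|partial i (partial j Theta) p| <= b.
  have E : (fun q => hess Theta q i j) = partial i (partial j Theta).
    by apply/funext => q; rewrite mxE.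
  move=> Dp; have := entry_le_Linfty (i := i) (j := j) oD _ TToo Dp.
  rewrite E mxE; apply.
  exact: is_Ck_continuous (is_Ck_partial i (is_Ck_partial j T2)).
apply: le_trans (mean_vol_density_le r0 T2 u3 eqn bu bT bTT) _.
have Linfty_ge0 m n (F : R * R -> 'M[R]_(m, n)) :
    0 <= fine (Linfty (disk (2 * r)) F).
  exact/fine_ge0/Lnorm_ge0.
have U0 : 0 <= U by exact: Linfty_ge0.
have a0 : 0 <= a by exact: Linfty_ge0.
have b0 : 0 <= b by exact: Linfty_ge0.
clearbody U a b; rewrite lee_fin -[X in _ <= X]mulrA ler_pM2l //.
rewrite !mul1r -exprVn.
have rho0 : 0 <= r^-1 by rewrite invr_ge0 ltW.
set rho := r^-1 in rho0 *; clearbody rho.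
set B := 2 * (16 + 4 * a + a ^+ 2 + b).
have a2 : 0 <= a ^+ 2 := sqr_ge0 a.
have quad :
    2 * (16 * rho ^+ 2 + 8 * rho * a + a ^+ 2 + b) <= B * (1 + rho ^+ 2).
  (* This absorbs the cross term: [8 * rho * a <= 4 * a * (1 + rho ^+ 2)]. *)
  have ? : 0 <= a * (rho - 1) ^+ 2 by rewrite mulr_ge0 ?sqr_ge0.
  have ? : 0 <= a ^+ 2 * rho ^+ 2 by rewrite mulr_ge0 ?sqr_ge0.
  have ? : 0 <= b * rho ^+ 2 by rewrite mulr_ge0 ?sqr_ge0.
  rewrite /B; nra.
have lin : 2 * (4 * rho + a) <= B * (1 + rho).
  have ? : 0 <= a * rho by rewrite mulr_ge0.
  have ? : 0 <= a ^+ 2 * rho by rewrite mulr_ge0.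
  have ? : 0 <= b * rho by rewrite mulr_ge0.
  rewrite /B; nra.
have -> : B * (1 + (1 + rho ^+ 2) * U ^+ 2 + (1 + rho) * U) =
    B + B * (1 + rho ^+ 2) * U ^+ 2 + B * (1 + rho) * U by ring.
apply: lerD; last exact: ler_wpM2r U0 _ _ lin.
apply: lerD; last exact: ler_wpM2r (sqr_ge0 U) _ _ quad.
by rewrite /B; lra.
Qed.
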